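(* Let $n\geqslant2$ and $p>1$. There exist a measurable function $Q\in L^p(\mathbb{B}^n)$ and a bounded homeomorphism $f:\mathbb{B}^n\setminus\{0\}\to\mathbb{R}^n$ (onto its image) which is a ring $Q$-mapping at $0$, such that $0$ is an essential singularity of $f$, i.e. $f$ has no limit (finite or infinite) as $x\to0$.
   Context: $\mathbb{B}^n$ is the open unit ball of $\mathbb{R}^n$, with Euclidean metric and Lebesgue measure $m$. For a family $\Gamma$ of curves in $\mathbb{R}^n$, a Borel $\rho\geqslant0$ is admissible if $\int_\gamma\rho\,ds\geqslant1$ for each locally rectifiable $\gamma\in\Gamma$, and $M_n(\Gamma)=\inf_\rho\int_{\mathbb{R}^n}\rho^n\,dm$. $\Gamma(E,F,H)$ is the family of continuous curves $\gamma:[0,1]\to\mathbb{R}^n$ with $\gamma(0)\in E$, $\gamma(1)\in F$, $\gamma(t)\in H$ for $t\in(0,1)$; $S(0,r)=\{|x|=r\}$, $A(0,r_1,r_2)=\{r_1<|x|<r_2\}$. A mapping $f:G\to\mathbb{R}^n$, $G=\mathbb{B}^n\setminus\{0\}$, is a ring $Q$-mapping at $0$ if for all $0<r_1<r_2<\infty$ and every Lebesgue measurable $\eta:(r_1,r_2)\to[0,\infty]$ with $\int_{r_1}^{r_2}\eta\,dr\geqslant1$: $M_n(f(\Gamma(S(0,r_1),S(0,r_2),A(0,r_1,r_2))))\leqslant\int_{A(0,r_1,r_2)\cap G}Q(x)\eta^n(|x|)\,dm(x)$ (only curves lying in $G$ are mapped). *)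

(* Defs.v *)
From HB Require Import structures.
From mathcomp Require Import all_boot all_order all_algebra.
From mathcomp Require Import all_classical all_reals all_analysis.
From mathcomp Require Import measurable_realfun.
Import Order.TTheory GRing.Theory Num.Theory.
Import numFieldNormedType.Exports.
Set Implicit Arguments.
Unset Strict Implicit.
Unset Printing Implicit Defensive.
Local Open Scope classical_set_scope.
Local Open Scope ring_scope.

Section Defs.
Variable R : realType.

(** Euclidean norm (the default norm on matrices is the max norm, so we
    define the Euclidean one explicitly). *)
Definition enorm (n : nat) (x : 'rV[R]_n) : R :=
  Num.sqrt (\sum_(i < n) x ord0 i ^+ 2).

Definition unit_ball (n : nat) : set 'rV[R]_n := [set x | enorm x < 1].
Definition punct_ball (n : nat) : set 'rV[R]_n :=
  [set x | enorm x < 1 /\ x <> 0].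
Definition sphere0 (n : nat) (r : R) : set 'rV[R]_n := [set x | enorm x = r].
Definition annulus0 (n : nat) (r1 r2 : R) : set 'rV[R]_n :=
  [set x | r1 < enorm x /\ enorm x < r2].

Arguments unit_ball : clear implicits.
Arguments punct_ball : clear implicits.
Arguments sphere0 : clear implicits.
Arguments annulus0 : clear implicits.

Record mspace := MSpace {
  ms_d : measure_display;
  ms_T : measurableType ms_d;
  ms_mu : {measure set ms_T -> \bar R} }.

(** lebn k = (R^(k+1), Borel sets, Lebesgue measure), built as the iterated
    product ((R x R) x ...) x R of one-dimensional Lebesgue measures. *)
Fixpoint lebn (k : nat) : mspace :=
  match k with
  | 0 => @MSpace _ (measurableTypeR R) (@lebesgue_measure R)
  | k'.+1 => @MSpace _ (ms_T (lebn k') * measurableTypeR R)%type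
      ((ms_mu (lebn k')) \x (@lebesgue_measure R))%E
  end.

Fixpoint coord (k : nat) : ms_T (lebn k) -> nat -> R :=
  match k return ms_T (lebn k) -> nat -> R with
  | 0 => fun y _ => y
  | k'.+1 => fun y i => if i == k'.+1 then y.2 else coord y.1 i
  end.

Definition vec (n : nat) (y : ms_T (lebn n.-1)) : 'rV[R]_n :=
  \row_(i < n) coord y i.

Definition open_sets (n : nat) : set_system 'rV[R]_n := @open 'rV[R]_n.
Arguments open_sets : clear implicits.
Definition borel_set (n : nat) (A : set 'rV[R]_n) : Prop :=
  <<s open_sets n >> A.
Definition borel_efun (n : nat) (g : 'rV[R]_n -> \bar R) : Prop :=
  forall B : set (\bar R), measurable B -> borel_set (g @^-1` B).
Definition borel_rfun (n : nat) (g : 'rV[R]_n -> R) : Prop :=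
  forall B : set R, measurable B -> borel_set (g @^-1` B).

Definition integral_Rn (n : nat) (g : 'rV[R]_n -> \bar R) : \bar R :=
  (\int[ms_mu (lebn n.-1)]_y g (vec y))%E.

(** Upper Lebesgue integral over R^n of a nonnegative function; it coincides
    with the Lebesgue integral for every nonnegative Lebesgue measurable g. *)
Definition uintegral_Rn (n : nat) (g : 'rV[R]_n -> \bar R) : \bar R :=
  ereal_inf [set integral_Rn h |
    h in [set h : 'rV[R]_n -> \bar R | borel_efun h /\ (forall x, (g x <= h x)%E)]].

(** completed (Lebesgue) measure on R, used for Lebesgue measurable eta *)
Definition clebR : mspace := @MSpace _ _ (@completed_lebesgue_measure R).

(** a curve is parametrized on [0,1]; values outside [0,1] are irrelevant *)
Definition curve (n : nat) := R -> 'rV[R]_n.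

Definition is_path (n : nat) (g : curve n) : Prop :=
  {within [set t : R | 0 <= t <= 1], continuous g}.

Definition Gamma (n : nat) (E F H : set 'rV[R]_n) : set (curve n) :=
  [set g | is_path g /\ E (g 0) /\ F (g 1) /\
           (forall t, 0 < t < 1 -> H (g t))].

Definition curve_length (n : nat) (g : curve n) (a b : R) : \bar R :=
  ereal_sup [set s : \bar R | exists (k : nat) (t : nat -> R),
    t 0%N = a /\ t k = b /\ (forall i, (i < k)%N -> t i <= t i.+1) /\
    s = (\sum_(i < k) enorm (g (t i.+1) - g (t i)))%:E].

Definition loc_rectifiable (n : nat) (g : curve n) : Prop :=
  forall a b, 0 <= a -> a <= b -> b <= 1 -> (curve_length g a b < +oo)%E.

Definition arc_param (n : nat) (g : curve n) (s : R) : R :=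
  inf [set t : R | 0 <= t <= 1 /\ (s%:E <= curve_length g 0 t)%E].

Definition line_integral (n : nat) (g : curve n) (rho : 'rV[R]_n -> \bar R)
  : \bar R :=
  (\int[@lebesgue_measure R]_(s in [set s : R | (0 <= s <= fine (curve_length g 0 1))%R])
      rho (g (arc_param g s)))%E.

Definition admissible (n : nat) (Gm : set (curve n)) (rho : 'rV[R]_n -> \bar R)
  : Prop :=
  borel_efun rho /\ (forall x, (0 <= rho x)%E) /\
  (forall g, Gm g -> loc_rectifiable g -> (1 <= line_integral g rho)%E).

Definition modulus (n : nat) (Gm : set (curve n)) : \bar R :=
  ereal_inf [set integral_Rn (fun x => (rho x ^+ n)%E) | rho in admissible Gm].

Definition image_family (n : nat) (f : 'rV[R]_n -> 'rV[R]_n)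
  (Gm : set (curve n)) : set (curve n) :=
  [set f \o g | g in [set g | Gm g /\
     (forall t, 0 <= t <= 1 -> punct_ball n (g t))]].

Definition ring_Q_mapping_at0 (n : nat) (f : 'rV[R]_n -> 'rV[R]_n)
  (Q : 'rV[R]_n -> R) : Prop :=
  forall r1 r2 : R, 0 < r1 -> r1 < r2 ->
  forall eta : R -> \bar R,
    measurable_fun (`]r1, r2[ : set (ms_T clebR)) (eta : ms_T clebR -> \bar R) ->
    (forall r, r1 < r < r2 -> (0 <= eta r)%E) ->
    (1 <= \int[ms_mu clebR]_(r in (`]r1, r2[ : set (ms_T clebR))) eta r)%E ->
    (modulus (image_family f
        (Gamma (sphere0 n r1) (sphere0 n r2) (annulus0 n r1 r2)))
     <= uintegral_Rn (fun x =>
          (\1_(annulus0 n r1 r2 `&` punct_ball n) x)%:E *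
          ((Q x)%:E * eta (enorm x) ^+ n)))%E.

Definition homeomorphism_on (n : nat) (D : set 'rV[R]_n)
  (f : 'rV[R]_n -> 'rV[R]_n) : Prop :=
  {within D, continuous f} /\
  (exists g : 'rV[R]_n -> 'rV[R]_n,
     (forall x, D x -> g (f x) = x) /\ {within f @` D, continuous g}).

Definition bounded_on (n : nat) (D : set 'rV[R]_n) (f : 'rV[R]_n -> 'rV[R]_n)
  : Prop :=
  exists M : R, forall x, D x -> enorm (f x) <= M.

Definition has_finite_limit_at0 (n : nat) (f : 'rV[R]_n -> 'rV[R]_n) : Prop :=
  exists L : 'rV[R]_n, forall e : R, 0 < e -> exists d : R, 0 < d /\
    forall x, punct_ball n x -> enorm x < d -> enorm (f x - L) < e.

Definition has_infinite_limit_at0 (n : nat) (f : 'rV[R]_n -> 'rV[R]_n) : Prop :=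
  forall M : R, exists d : R, 0 < d /\
    forall x, punct_ball n x -> enorm x < d -> M < enorm (f x).

Definition essential_singularity_at0 (n : nat) (f : 'rV[R]_n -> 'rV[R]_n)
  : Prop :=
  ~ has_finite_limit_at0 f /\ ~ has_infinite_limit_at0 f.

Definition in_Lp_ball (n : nat) (p : R) (Q : 'rV[R]_n -> R) : Prop :=
  (integral_Rn (fun x => (\1_(unit_ball n) x)%:E * (`|Q x| `^ p)%:E) < +oo)%E.

End Defs.

Arguments unit_ball {R} n.
Arguments punct_ball {R} n.
Arguments sphere0 {R} n r.
Arguments annulus0 {R} n r1 r2.
Arguments open_sets {R} n.

(* Main.v *)
Require Import Defs.
From HB Require Import structures.
From mathcomp Require Import all_boot all_order all_algebra.
From mathcomp Require Import all_classical all_reals all_analysis.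
From mathcomp Require Import measurable_realfun.
From mathcomp Require Import lra ring.
Import Order.TTheory GRing.Theory Num.Theory.
Import numFieldNormedType.Exports.
Local Open Scope classical_set_scope.
Local Open Scope ring_scope.

(** Write |x| for the Euclidean norm and `|x| for the sup norm on R^n, and let
    m = n - 1.  The example is f(x) = (1 + |x|^a) x / `|x| with a = 1 / (2 m p)
    and Q(x) = K |x|^(- a m): then |Q|^p is a multiple of |x|^(-1/2), while f
    maps spheres onto boundaries of cubes that shrink to the unit cube, so it
    has no limit at 0.

    Let D = r2^a - r1^a.  The image of the ring r1 < |x| < r2 is the shell
    between two concentric cubes at sup distance D, so the constant density 1/D
    on that shell is admissible and the modulus is at most C D^(-m).  On the
    other side, int Q eta^n dx dominates a multiple of
    int (r^(a-1))^(-m) eta(r)^n dr, and since r^(a-1) has integral D/a over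
    ]r1, r2[, Young's inequality and int eta >= 1 bound the latter below by
    c D^(-m).  Taking K large makes the two bounds meet.

    Cubes, rather than balls, on the image side keep the volume of the shell
    elementary. *)

(** * Integration preliminaries: monotonicity, contractions, completed versus Borel *)

(** The integral of a nonnegative function is a supremum over simple minorants, and each simple
    minorant of [f] is one of [g]. This form serves for integrands such as the majorants [h] of the
    upper integral, composed with [vec]. *)
Lemma ge0_le_integral_nomeas d (T : measurableType d) (R : realType)
    (mu : {measure set T -> \bar R}) (D : set T) (f g : T -> \bar R) :
  (forall x, D x -> 0 <= f x)%E -> (forall x, D x -> f x <= g x)%E ->
  (\int[mu]_(x in D) f x <= \int[mu]_(x in D) g x)%E.
Proof.
move=> f0 fg; rewrite !ge0_integralE//; last first.
  by move=> x Dx; rewrite (le_trans (f0 _ Dx)) ?fg.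
apply: ge_ereal_sup => _ [h hf <-]; apply: ereal_sup_ubound; exists h => //= x.
rewrite (le_trans (hf x))// !patchE; case: ifPn => //; rewrite inE; exact: fg.
Qed.

(** Works on outer measures, hence for arbitrary sets: a cover of [A] by intervals []a, b]] yields a
    cover of the image by the intervals [[f a, f b]], none of them longer. *)
Lemma lebesgue_measure_image_le (R : realType) (f : R -> R) (A : set R) :
  {homo f : x y / x <= y} -> (forall x y, x <= y -> f y - f x <= y - x) ->
  (@lebesgue_measure R (f @` A) <= @lebesgue_measure R A)%E.
Proof.
move=> fnd flip; apply: le_ereal_inf_tmp => _ [F [mF AF] <-].
pose mu := ((@wlength R idfun)^*)%mu.
have : (mu (f @` A) <= mu (\bigcup_k (f @` F k)))%E.
  apply: le_outer_measure => _ [x /AF [k _ Fkx] <-].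
  by exists k => //; exists x.
move=> /le_trans; apply.
have := outer_measure_sigma_subadditive mu (fun k => f @` F k).
move=> /le_trans; apply; apply: lee_nneseries => // k _.
have [[a b] /= _ <-] := mF k.
have [ab|ba] := ltP a b; last first.
  rewrite set_itv_ge ?bnd_simp -?leNgt// image_set0.
  by rewrite /mu outer_measure0.
have : (mu (f @` `]a, b]%classic) <= mu `[f a, f b]%classic)%E.
  apply: le_outer_measure => _ [x + <-] /=.
  by rewrite !in_itv/= => /andP[/ltW ax xb]; rewrite !fnd.
move=> /le_trans; apply.
rewrite wlength_itv/= lte_fin ab.
have -> : mu `[f a, f b]%classic = @lebesgue_measure R `[f a, f b] by [].
rewrite lebesgue_measure_itv/= lte_fin; case: ifPn => _.
  by rewrite -!EFinD lee_fin flip// ltW.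
by rewrite -EFinD lee_fin subr_ge0 ltW.
Qed.

(** A set of the completed sigma-algebra is a Borel set joined with a part of a null set; [B] is the
    Borel piece. *)
Lemma completed_lebesgue_inner_borel (R : realType) (E : set (ms_T (clebR R))) :
  measurable E -> exists B : set (measurableTypeR R),
    [/\ measurable B, B `<=` E & (ms_mu (clebR R) E <= @lebesgue_measure R B)%E].
Proof.
rewrite /= /clebR/= => mE.
have : @completed_algebra_gen _ _ R (@lebesgue_measure R) E.
  by rewrite -g_sigma_completed_algebra_genE completed_caratheodory_measurable.
move=> [B mB [N [M [mM M0 NM]]] BNE]; exists B; split => //.
  by rewrite -BNE; left.
pose mu := ((@wlength R idfun)^*)%mu.
have : (mu E <= mu B + mu N)%E by rewrite -BNE outer_measureU2.
move=> /le_trans; apply.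
have : (mu N <= 0)%E by rewrite -M0; exact: le_outer_measure.
by move=> N0; rewrite -[leRHS]adde0 leeD2l.
Qed.

Section borel_simple_minorant.
Import HBNNSimple.

(** Passes from [eta] and the completed measure to a Borel function, to which Tonelli on Borel
    products applies. A simple [h] below [eta] with integral above [c] exists by definition of the
    supremum; its level sets are then shrunk to Borel sets of no smaller measure. *)
Lemma borel_simple_minorant (R : realType) (D : set (ms_T (clebR R)))
    (eta : R -> \bar R) (c : R) :
  (forall r, D r -> 0 <= eta r)%E ->
  (c%:E < \int[ms_mu (clebR R)]_(r in D) eta r)%E ->
  exists g : R -> R, [/\ measurable_fun [set: R] g, forall r, 0 <= g r,
    forall r, D r -> ((g r)%:E <= eta r)%E, forall r, ~ D r -> g r = 0 &
    (c%:E <= \int[@lebesgue_measure R]_r (g r)%:E)%E].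
Proof.
move=> eta0; rewrite ge0_integralE// => /ereal_sup_gt[_ [h /= hle <-] ch].
have /choice[B BP] : forall x : R, exists B : set (measurableTypeR R),
    [/\ measurable B, B `<=` h @^-1` [set x] &
    (ms_mu (clebR R) (h @^-1` [set x]) <= @lebesgue_measure R B)%E].
  move=> x; apply: completed_lebesgue_inner_borel.
  exact: measurable_sfunP.
(* No sign condition on [x] is required: if [r] lies in [B x], then [x = h r >= 0]. *)
have B0 x r : 0 <= x * \1_(B x) r.
  rewrite indicE; case: (boolP (r \in B x)) => [|_]; rewrite ?mulr0// mulr1.
  by rewrite inE; have [_ sub _] := BP x; move=> /sub <-.
pose g r := \sum_(x \in range h) x * \1_(B x) r.
have gh r : g r <= h r.
  rewrite /g [leRHS]fimfunE !fsbig_finite//= big_seq [leRHS]big_seq.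
  apply: ler_sum => x; rewrite in_fset_set// inE => -[t _ <-]; rewrite ler_wpM2l// !indicE ler_nat.
  have [_ sub _] := BP (h t).
  by case: (boolP (r \in B (h t))) => //; rewrite inE => /sub; rewrite -inE => ->.
have mg : measurable_fun [set: R] g.
  rewrite /g; under eq_fun do rewrite fsbig_finite//.
  apply: measurable_sum => x; apply: measurable_funM => //.
  by apply: measurable_indic; have [] := BP x.
exists g; split => //.
- by move=> r; rewrite /g fsbig_finite//; apply: sumr_ge0 => x _.
- move=> r Dr; rewrite (@le_trans _ _ (h r)%:E) ?lee_fin//.
  by rewrite (le_trans (hle r))// patchE mem_set.
- move=> r Dr; apply/eqP; rewrite eq_le; apply/andP; split.
    rewrite (le_trans (gh r))// -lee_fin (le_trans (hle r))// patchE memNset//.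
  by rewrite /g fsbig_finite//; apply: sumr_ge0 => x _.
- rewrite (le_trans (ltW ch))//.
  under eq_integral do rewrite /g -fsumEFin//.
  rewrite ge0_integral_fsum//; last 2 first.
  + move=> x; apply/measurable_EFinP/measurable_funM => //.
    by apply: measurable_indic; have [] := BP x.
  + by move=> x r _; rewrite lee_fin.
  rewrite sintegralE; apply: lee_fsum => // x [t _ <-].
  have [mB _ le] := BP (h t).
  under eq_integral do rewrite EFinM.
  rewrite ge0_integralZl//; last 2 first.
  + exact/measurable_EFinP/measurable_indic.
  + by rewrite lee_fin.
  rewrite integral_indic// setIT lee_wpmul2l// lee_fin//.
Qed.

End borel_simple_minorant.

(** * The substitution r = sqrt (a^2 + t^2) on the line *)

Section hypotenuse.
Context {R : realType}.
Implicit Types a t : R.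

Definition hypot a t := Num.sqrt (a ^+ 2 + t ^+ 2).

Lemma measurable_hypot a : measurable_fun [set: R] (hypot a).
Proof.
apply: (@measurableT_comp _ _ _ _ _ _ (@Num.sqrt R)).
  by apply: continuous_measurable_fun => x; exact: sqrt_continuous.
by apply: measurable_funD => //; exact: measurable_funX.
Qed.

(* On [t >= 0] the map [t |-> sqrt (a^2 + t^2)] is a monotone contraction onto [[a, +oo[]. *)
Lemma lebesgue_measure_hypot_preimage a (B : set R) : 0 <= a -> measurable B ->
  (@lebesgue_measure R (B `&` `]a, +oo[) <= @lebesgue_measure R (hypot a @^-1` B))%E.
Proof.
move=> a0 mB.
(* Freezing [hypot a] on the negative half-line makes it nondecreasing and 1-Lipschitz on all of
   R. *)
pose f t := hypot a (Num.max t 0).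
have max_nd (x y : R) : x <= y -> Num.max x 0 <= Num.max y 0.
  by case: (lerP y 0); case: (lerP x 0); lra.
have max_ge0 (x : R) : 0 <= Num.max x 0 by case: (lerP x 0); lra.
have f_nd : {homo f : x y / x <= y}.
  move=> x y xy; rewrite /f /hypot ler_wsqrtr// lerD2l ler_sqr ?nnegrE//.
  exact: max_nd.
have f_lip (x y : R) : x <= y -> f y - f x <= y - x.
  move=> xy.
  have fmax : Num.max y 0 - Num.max x 0 <= y - x.
    by case: (lerP y 0); case: (lerP x 0); lra.
  apply: le_trans fmax.
  have := max_nd _ _ xy; have := max_ge0 x.
  rewrite /f /hypot; move: (Num.max x 0) (Num.max y 0) => u v u0 uv.
  rewrite lerBlDr -[leRHS]ger0_norm; last first.
    by rewrite addr_ge0 ?subr_ge0// sqrtr_ge0.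
  rewrite -sqrtr_sqr ler_wsqrtr//.
  set s := Num.sqrt _.
  have s2 : s ^+ 2 = a ^+ 2 + u ^+ 2 by rewrite sqr_sqrtr// addr_ge0 ?sqr_ge0.
  (* Because [u <= s], the square of [v - u + s] is at least a^2 + v^2. *)
  have us : u <= s.
    by rewrite -(ger0_norm u0) -sqrtr_sqr ler_wsqrtr// lerDr sqr_ge0.
  nra.
pose T := [set t : R | 0 < t] `&` (hypot a @^-1` B).
apply: (@le_trans _ _ (@lebesgue_measure R (f @` T))); last first.
  apply: le_trans (lebesgue_measure_image_le _ _ _ f_nd f_lip) _.
  by apply: le_outer_measure => t [].
apply: le_outer_measure => r [Br]; rewrite /= in_itv/= andbT => ar.
have ra : 0 < r ^+ 2 - a ^+ 2 by nra.
have hr : hypot a (Num.sqrt (r ^+ 2 - a ^+ 2)) = r.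
  rewrite /hypot sqr_sqrtr ?(ltW ra)// addrC subrK sqrtr_sqr ger0_norm//; lra.
exists (Num.sqrt (r ^+ 2 - a ^+ 2)).
  by split => /=; [rewrite sqrtr_gt0|rewrite hr].
by rewrite /f max_l ?sqrtr_ge0.
Qed.

(** The substitution has Jacobian r / sqrt (r^2 - a^2) >= 1. Instead of computing it, Lebesgue
    measure on ]a, +oo[ ([m1]) is compared set by set with the pushforward of Lebesgue measure by
    [hypot a] ([m2]). *)
Lemma integral_hypot_ge a (phi : R -> \bar R) : 0 <= a ->
  measurable_fun [set: R] phi -> (forall r, 0 <= phi r)%E ->
  (\int[@lebesgue_measure R]_(r in `]a, +oo[) phi r <=
   \int[@lebesgue_measure R]_t phi (hypot a t))%E.
Proof.
move=> a0 mphi phi0.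
have mh : @measurable_fun _ _ (measurableTypeR R) (measurableTypeR R) setT (hypot a) := measurable_hypot a.
have mD : measurable (`]a, +oo[%classic : set (measurableTypeR R)) by exact: measurable_itv.
pose m1 : {measure set (measurableTypeR R) -> \bar R} := mrestr (@lebesgue_measure R) mD.
pose m2 : {measure set (measurableTypeR R) -> \bar R} :=
  measure_function_pushforward__canonical__measure_function_Measure (@lebesgue_measure R) mh.
rewrite (eq_measure_integral m1); last first.
  by move=> A mA AD; rewrite /m1/= /mrestr setIidl.
apply: (@le_trans _ _ (\int[m2]_(r in `]a, +oo[) phi r)%E).
  apply: ge0_le_measure_integral => // S mS.
  exact: lebesgue_measure_hypot_preimage.
rewrite /m2 ge0_integral_pushforward//; last exact: measurable_funTS.
apply: ge0_subset_integral => //=.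
- by rewrite -[X in measurable X]setTI; exact: (mh measurableT _ mD).
- exact: (measurableT_comp mphi mh).
Qed.

End hypotenuse.

(** * Cubes and sigma-finiteness for the iterated product measure on R^(k+1) *)

Section iterated_lebesgue.
Context {R : realType}.

Lemma measurable_coord k i : measurable_fun setT (fun y : ms_T (lebn R k) => Defs.coord y i).
Proof.
elim: k i => [|k IH] i /=; first exact: measurable_id.
case: eqP => _; first exact: measurable_snd.
exact: (measurableT_comp (IH i) measurable_fst).
Qed.

Lemma measurable_enorm_vec k :
  measurable_fun setT (fun y : ms_T (lebn R k) => enorm (@vec R k.+1 y)).
Proof.
rewrite /enorm; apply: (@measurableT_comp _ _ _ _ _ _ (@Num.sqrt R)).
  by apply: continuous_measurable_fun => x; exact: sqrt_continuous.
apply: measurable_sum => i; apply: measurable_funX => /=.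
under eq_fun do rewrite mxE.
exact: measurable_coord.
Qed.

Definition cube k (I : set R) : set (ms_T (lebn R k)) :=
  [set y | forall i, (i <= k)%N -> I (Defs.coord y i)].

Lemma cubeS k (I : set R) : cube k.+1 I = cube k I `*` I.
Proof.
apply/seteqP; split => [y yI|y [yI1 yI2] i].
  split => [i ik|].
    by have := yI i (leqW ik); rewrite /= eqn_leq [(k < i)%N]ltnNge ik andbF.
  by have := yI k.+1 (leqnn _); rewrite /= eqxx.
rewrite leq_eqVlt /= => /orP[/eqP->|]; first by rewrite eqxx.
by rewrite ltnS => ik; rewrite ltn_eqF ?ltnS//; exact: yI1.
Qed.

Lemma measurable_cube k (I : set R) : measurable I -> measurable (cube k I).
Proof.
move=> mI; elim: k => [|k IH].
  rewrite (_ : cube 0 I = I)//; apply/seteqP; split => [y /(_ 0%N)|y Iy i _ //].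
  exact.
by rewrite cubeS; exact: measurableX.
Qed.

Lemma lebn_cube k (I : set R) (s : R) : measurable I ->
  @lebesgue_measure R I = s%:E -> ms_mu (lebn R k) (cube k I) = (s ^+ k.+1)%:E.
Proof.
move=> mI Is; elim: k => [|k IH].
  rewrite (_ : cube 0 I = I)//.
  by apply/seteqP; split => [y /(_ 0%N)|y Iy i _ //]; exact.
rewrite cubeS /= product_measure1E//; last exact: measurable_cube.
by rewrite IH [X in (_ * X)%E]Is -EFinM -exprSr.
Qed.

(** [lebn] records a bare measure, so the sigma-finiteness needed for Tonelli is recovered here from
    an exhaustion by cubes. *)
Lemma lebn_sigma_finite k : sigma_finite setT (ms_mu (lebn R k)).
Proof.
exists (fun j : nat => cube k `[- j%:R, j%:R]%classic).
  apply/seteqP; split => // y _.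
  exists (Num.bound (\sum_(i < k.+1) `|Defs.coord y i|)) => // i ik /=.
  rewrite in_itv/= -ler_norml ltW//.
  apply: le_lt_trans (archi_boundP (sumr_ge0 _ _)) => //.
  by rewrite (bigD1 (Ordinal (ik : (i < k.+1)%N)))//= lerDl sumr_ge0.
move=> j; split; first exact: measurable_cube.
rewrite (@lebn_cube _ _ (j%:R + j%:R)) ?ltry//.
rewrite lebesgue_measure_itv/= lte_fin; case: ifPn => [_|].
  by rewrite -EFinD opprK.
by rewrite -leNgt => j0; congr EFin; have := ler0n R j; lra.
Qed.

(** The norm on row vectors is the max norm, so its balls are cubes; a boolean equality lets
    indicators be rewritten. *)
Lemma le_norm_vec k (y : ms_T (lebn R k)) (r : R) : 0 <= r ->
  (`|@vec R k.+1 y| <= r) = (y \in cube k `[- r, r]%classic).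
Proof.
move=> r0; rewrite -[`|_|]/(mx_norm _) mx_normrE.
apply/bigmax_leP/idP => [[_ yr]|].
  rewrite inE => i ik /=; rewrite in_itv/= -ler_norml.
  by have := yr (ord0, Ordinal (ik : (i < k.+1)%N)) isT; rewrite mxE.
rewrite inE => yr; split => // -[i j] _ /=; rewrite mxE ler_norml.
by have := yr j (ltn_ord j); rewrite /= in_itv.
Qed.

Lemma lt_norm_vec k (y : ms_T (lebn R k)) (r : R) : 0 < r ->
  (`|@vec R k.+1 y| < r) = (y \in cube k `]- r, r[%classic).
Proof.
move=> r0; rewrite -[`|_|]/(mx_norm _) mx_normrE.
apply/bigmax_ltP/idP => [[_ yr]|].
  rewrite inE => i ik /=; rewrite in_itv/= -ltr_norml.
  by have := yr (ord0, Ordinal (ik : (i < k.+1)%N)) isT; rewrite mxE.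
rewrite inE => yr; split => // -[i j] _ /=; rewrite mxE ltr_norml.
by have := yr j (ltn_ord j); rewrite /= in_itv.
Qed.

Lemma lebn_sym_cube k (r : R) : 0 < r ->
  ms_mu (lebn R k) (cube k `[- r, r]%classic) = ((2 * r) ^+ k.+1)%:E /\
  ms_mu (lebn R k) (cube k `]- r, r[%classic) = ((2 * r) ^+ k.+1)%:E.
Proof.
move=> r0; split; apply: lebn_cube => //; rewrite lebesgue_measure_itv/= lte_fin.
  by rewrite ifT ?gtrN// -EFinD; congr EFin; lra.
by rewrite ifT ?gtrN// -EFinD; congr EFin; lra.
Qed.

End iterated_lebesgue.

(** * Lower bound for integrals of radial functions *)

Section radial.
Context {R : realType}.

(** The hypothesis on [m1] is packed into a sigma-finite measure structure so that the
    Fubini-Tonelli theorems apply to it. *)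
Lemma sigma_finite_tonelli d1 d2 (T1 : measurableType d1) (T2 : measurableType d2)
    (m1 : {measure set T1 -> \bar R}) (m2 : {sigma_finite_measure set T2 -> \bar R})
    (f : T1 * T2 -> \bar R) :
  sigma_finite setT m1 -> measurable_fun setT f -> (forall x, 0 <= f x)%E ->
  (\int[(m1 \x m2)%E]_z f z = \int[m1]_x \int[m2]_y f (x, y))%E /\
  (\int[m1]_x \int[m2]_y f (x, y) = \int[m2]_y \int[m1]_x f (x, y))%E.
Proof.
move=> sf mf f0.
pose Hs := isSFinite.Build _ _ _ _ (sfinite_measure_sigma_finite sf).
pose Hsf := isSigmaFinite.Build _ _ _ _ sf.
pose m := HB.pack_for {sigma_finite_measure set T1 -> \bar R} (Measure.sort m1) Hs Hsf.
split; first exact: (@fubini_tonelli1 _ _ _ _ _ m m2).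
exact: (@fubini_tonelli _ _ _ _ _ m m2).
Qed.

Lemma enorm_vecS k (y : ms_T (lebn R k.+1)) :
  enorm (@vec R k.+2 y) = hypot (enorm (@vec R k.+1 y.1)) y.2.
Proof.
rewrite /enorm /hypot big_ord_recr/= sqr_sqrtr; last first.
  by apply: sumr_ge0 => i _; exact: sqr_ge0.
congr (Num.sqrt (_ + _)); last by rewrite mxE /= eqxx.
by apply: eq_bigr => i _; rewrite !mxE /= ltn_eqF.
Qed.

(** The side r / (k+2) is a crude choice: k+1 squares of it sum to less than r^2. This cube replaces
    the ball of radius r, whose volume is less elementary. *)
Lemma enorm_vec_cube k (y : ms_T (lebn R k)) (r : R) : 0 < r ->
  cube k `[0, r / k.+2%:R]%classic y -> enorm (@vec R k.+1 y) < r.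
Proof.
move=> r0 yr.
have c0 : 0 < r / k.+2%:R by rewrite divr_gt0.
rewrite -(ger0_norm (ltW r0)) -sqrtr_sqr ltr_sqrt ?exprn_gt0//.
apply: (@le_lt_trans _ _ (\sum_(i < k.+1) (r / k.+2%:R) ^+ 2)).
  apply: ler_sum => i _; rewrite mxE.
  have := yr i (ltn_ord i); rewrite /= in_itv/= => /andP[y0 y1].
  by rewrite ler_sqr ?nnegrE// ltW.
rewrite sumr_const card_ord -[ltLHS]mulr_natl expr_div_n mulrCA gtr_pMr ?exprn_gt0//.
rewrite ltr_pdivrMr ?exprn_gt0// mul1r -natrX ltr_nat.
by rewrite expnS expn1 (@leq_ltn_trans (k.+1 * k.+2))// ?leq_pmulr// ltn_pmul2r.
Qed.

(* Slicing along the last coordinate replaces integration in polar coordinates. *)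
Lemma radial_integral_ge (k : nat) (phi : R -> \bar R) :
  measurable_fun [set: R] phi -> (forall r, 0 <= phi r)%E ->
  (\int[@lebesgue_measure R]_(r in `]0%R, +oo[)
     (((r / k.+2%:R) ^+ k.+1)%:E * phi r) <=
   \int[ms_mu (lebn R k.+1)]_y phi (enorm (@vec R k.+2 y)))%E.
Proof.
move=> mphi phi0.
have mn := @measurable_enorm_vec R k.
have [E1 _] := @sigma_finite_tonelli _ _ _ _ (ms_mu (lebn R k)) (@lebesgue_measure R)
   (fun y => phi (enorm (@vec R k.+2 y))) (lebn_sigma_finite k)
   (measurableT_comp mphi (measurable_enorm_vec k.+1)) (fun=> phi0 _).
rewrite [leRHS]E1 {E1}.
(* With x' the first coordinates, [integral_hypot_ge] trades the last coordinate for the radius r,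
   which ranges over r > |x'|; [A] is the resulting domain. *)
pose A : set (ms_T (lebn R k) * measurableTypeR R) :=
  [set z | enorm (@vec R k.+1 z.1) < z.2].
have mA : measurable A.
  rewrite (_ : A = (fun z : ms_T (lebn R k) * measurableTypeR R =>
     z.2 - enorm (@vec R k.+1 z.1)) @^-1` `]0, +oo[); last first.
    by apply/seteqP; split => z /=; rewrite in_itv/= andbT subr_gt0.
  rewrite -[X in measurable X]setTI.
  suff : measurable_fun setT (fun z : ms_T (lebn R k) * measurableTypeR R =>
     z.2 - enorm (@vec R k.+1 z.1)) by exact.
  apply: measurable_funB; first exact: measurable_snd.
  exact: (measurableT_comp mn measurable_fst).
pose F (z : ms_T (lebn R k) * measurableTypeR R) := ((\1_A z)%:E * phi z.2)%E.
have F0 z : (0 <= F z)%E by rewrite mule_ge0// lee_fin.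
have mF : measurable_fun setT F.
  apply: emeasurable_funM; first exact/measurable_EFinP/measurable_indic.
  exact: (measurableT_comp mphi measurable_snd).
have [_ E2] := @sigma_finite_tonelli _ _ _ _ (ms_mu (lebn R k)) (@lebesgue_measure R)
   F (lebn_sigma_finite k) mF F0.
apply: (@le_trans _ _ (\int[ms_mu (lebn R k)]_x \int[@lebesgue_measure R]_y F (x, y))%E); last first.
  apply: ge0_le_integral_nomeas => x _; first exact: integral_ge0.
  under [leRHS]eq_integral do rewrite enorm_vecS/=.
  apply: le_trans (integral_hypot_ge _ _ _ mphi phi0); last exact: sqrtr_ge0.
  rewrite [leRHS]integral_mkcond; apply: ge0_le_integral_nomeas => // y _.
  rewrite patchE /F indicE.
  case: (boolP (_ \in A)); rewrite ?mul0e; last by case: ifP.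
  by rewrite inE /A/= mul1e => xy; rewrite mem_set//= in_itv/= andbT.
(* After the swap, for fixed r the variable x' fills the ball |x'| < r, which contains a cube of
   volume (r / (k+2))^(k+1). *)
rewrite E2 integral_mkcond.
apply: ge0_le_integral_nomeas => r _.
  rewrite patchE; case: ifPn => //; rewrite inE/= in_itv/= andbT => r0.
  by rewrite mule_ge0// lee_fin exprn_ge0// divr_ge0// ltW.
rewrite patchE; case: ifPn; last by move=> _; exact: integral_ge0.
rewrite inE/= in_itv/= andbT => r0.
pose C := cube k `[0, r / k.+2%:R]%classic.
have mC : measurable C by exact: measurable_cube.
apply: (@le_trans _ _ (\int[ms_mu (lebn R k)]_x ((\1_C x)%:E * phi r))%E).
  rewrite ge0_integralZr//; last exact/measurable_EFinP/measurable_indic.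
  rewrite integral_indic// setIT lee_wpmul2r// (@lebn_cube _ _ _ (r / k.+2%:R))//.
  by rewrite lebesgue_measure_itv/= lte_fin ifT ?divr_gt0// -EFinD subr0.
apply: ge0_le_integral_nomeas => x _; first by rewrite mule_ge0// lee_fin.
rewrite lee_wpmul2r// lee_fin !indicE ler_nat.
case: (boolP (_ \in C)) => //; rewrite inE => /(enorm_vec_cube _ _ _ r0) xr.
by rewrite mem_set.
Qed.

End radial.

(** * The weighted power integral on an interval *)

Section one_dimensional.
Context {R : realType}.

Lemma mul_exprn_le_add (m : nat) (a b : R) : 0 <= a -> 0 <= b ->
  a * b ^+ m <= a ^+ m.+1 + b ^+ m.+1.
Proof.
move=> a0 b0; have [ab|ba] := leP a b.
  rewrite exprS [in leRHS]exprS ler_wpDl ?mulr_ge0 ?exprn_ge0//.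
  by rewrite ler_wpM2r ?exprn_ge0.
rewrite ler_wpDr ?exprn_ge0// exprS ler_wpM2l//.
by rewrite lerXn2r ?nnegrE// ltW.
Qed.

(** This is [mul_exprn_le_add] for [g] and [l * w], divided by [w ^+ m]. The parameter [l] is left
    free, to be tuned after integration. *)
Lemma weighted_young (m : nat) (g l w : R) : 0 <= g -> 0 < l -> 0 < w ->
  l ^+ m * g <= w ^- m * g ^+ m.+1 + l ^+ m.+1 * w.
Proof.
move=> g0 l0 w0; have wm0 : 0 < w ^+ m by rewrite exprn_gt0.
rewrite -(ler_pM2l wm0) mulrDr mulVKf ?gt_eqF//.
have := mul_exprn_le_add m g (l * w) g0 (ltW (mulr_gt0 l0 w0)).
rewrite !exprMn.
rewrite (_ : w ^+ m * (l ^+ m * g) = g * (l ^+ m * w ^+ m)); last by ring.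
by rewrite (_ : w ^+ m * (l ^+ m.+1 * w) = l ^+ m.+1 * w ^+ m.+1)// [w ^+ m.+1]exprSr; ring.
Qed.

Lemma continuous_powR_gt0 (x a : R) : 0 < x -> {for x, continuous (@powR R ^~ a)}.
Proof.
move=> x0; apply: differentiable_continuous; apply/derivable1_diffP.
by apply: derivable_powR; rewrite in_itv/= x0.
Qed.

Lemma integral_powR_derive (a r1 r2 : R) : 0 < r1 -> r1 < r2 ->
  (\int[@lebesgue_measure R]_(r in `]r1, r2[) (a * r `^ (a - 1))%:E =
   (r2 `^ a - r1 `^ a)%:E)%E.
Proof.
move=> r10 r12.
have gt0 x : r1 <= x -> 0 < x by exact: lt_le_trans.
have cw x : r1 <= x -> {for x, continuous (fun r => a * r `^ (a - 1))}.
  move=> rx; apply: continuousM; first exact: cvg_cst.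
  by apply: continuous_powR_gt0; exact: gt0.
rewrite -(@integral_itv_bndoo _ _ _ _ true false); last first.
  apply/measurable_EFinP; apply: measurable_funM => //.
  by apply: measurable_funTS; exact: measurable_powR.
rewrite (@continuous_FTC2 _ _ (@powR R ^~ a))// ?EFinB//.
- apply: continuous_in_subspaceT => x; rewrite inE/= in_itv/= => /andP[r1x _].
  exact: cw.
- split.
  + by move=> x; rewrite in_itv/= => /andP[/ltW r1x _]; apply: derivable_powR; rewrite in_itv/= gt0.
  + by apply: cvg_at_right_filter; exact: continuous_powR_gt0.
  + by apply: cvg_at_left_filter; apply: continuous_powR_gt0; apply: gt0; exact: ltW.
- move=> x; rewrite in_itv/= => /andP[/ltW r1x _].
  by rewrite powR_derive1// in_itv/= gt0.
Qed.

Lemma measurable_powR_weight (m : nat) (a : R) (g : R -> R) :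
  0 < a -> measurable_fun [set: R] g ->
  measurable_fun [set: R] (fun r => (a * r `^ (a - 1)) ^- m * g r ^+ m.+1).
Proof.
move=> a0 mg; apply: measurable_funM; last exact: measurable_funX.
have -> : (fun r : R => (a * r `^ (a - 1)) ^- m) =
    (fun r : R => ((a * r `^ (a - 1)) ^+ m) `^ (-1)).
  by apply/funext => r; rewrite powR_inv1// exprn_ge0// mulr_ge0 ?powR_ge0// ltW.
apply: (@measurableT_comp _ _ _ _ _ _ (@powR R ^~ (-1))).
  exact: measurable_powR.
by apply: measurable_funX; apply: measurable_funM => //; exact: measurable_powR.
Qed.

(** [weighted_young] is integrated with [w] the derivative of r^a, whose integral is [L]. The
    hypothesis asks for 1/2 rather than 1, as [g] will be a minorant of [eta] that loses some
    mass. *)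
Lemma weighted_power_integral_ge (m : nat) (a r1 r2 : R) (g : R -> R) :
  0 < a -> 0 < r1 -> r1 < r2 -> measurable_fun [set: R] g ->
  (forall r, 0 <= g r) ->
  (2^-1%:E <= \int[@lebesgue_measure R]_(r in `]r1, r2[) (g r)%:E)%E ->
  (((4 * (r2 `^ a - r1 `^ a)) ^- m / 4)%:E <=
   \int[@lebesgue_measure R]_(r in `]r1, r2[)
     ((a * r `^ (a - 1)) ^- m * g r ^+ m.+1)%:E)%E.
Proof.
move=> a0 r10 r12 mg g0 ig; set I := leRHS.
set L := r2 `^ a - r1 `^ a.
have L0 : 0 < L.
  by rewrite subr_gt0 gt0_ltr_powR// ?nnegrE ?(ltW r10)// (le_trans (ltW r10))// ltW.
(* Chosen so that [l ^+ m.+1 * L] is [l ^+ m / 4], half of the left side [l ^+ m / 2]. *)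
pose l := (4 * L)^-1.
have l0 : 0 < l by rewrite invr_gt0 mulr_gt0.
pose w r := a * r `^ (a - 1).
have mw : measurable_fun [set: R] w.
  by apply: measurable_funM => //; exact: measurable_powR.
have w0 r : r1 < r -> 0 < w r.
  by move=> r1r; rewrite mulr_gt0// powR_gt0// (lt_trans r10).
pose D : set (measurableTypeR R) := `]r1, r2[%classic.
have mD : measurable D by exact: measurable_itv.
have mwg : measurable_fun [set: R] (fun r => w r ^- m * g r ^+ m.+1).
  exact: measurable_powR_weight.
have wg0 r : D r -> 0 <= w r ^- m * g r ^+ m.+1.
  rewrite /D/= in_itv/= => /andP[/w0 wr _].
  by rewrite mulr_ge0 ?invr_ge0 ?exprn_ge0// ltW.
have key : ((l ^+ m)%:E * (2^-1)%:E <= I + (l ^+ m.+1)%:E * L%:E)%E.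
  have : ((l ^+ m)%:E * (2^-1)%:E <= (l ^+ m)%:E * \int[@lebesgue_measure R]_(r in D) (g r)%:E)%E.
    by rewrite lee_wpmul2l// lee_fin exprn_ge0// ltW.
  move=> /le_trans; apply.
  have mE (u : R -> R) : measurable_fun [set: R] u ->
      measurable_fun D (EFin \o u) by move=> mu; apply/measurable_EFinP; exact: measurable_funTS.
  have wD0 (r : R) : D r -> 0 < w r by rewrite /D/= in_itv/= => /andP[/w0].
  rewrite -ge0_integralZl//; last 3 first.
  - exact: mE.
  - by move=> r _; rewrite lee_fin.
  - by rewrite lee_fin exprn_ge0// ltW.
  rewrite -(integral_powR_derive a r1 r2)// -ge0_integralZl//; last 3 first.
  - exact: (mE w).
  - by move=> r /wD0/ltW; rewrite lee_fin.
  - by rewrite lee_fin exprn_ge0// ltW.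
  rewrite /I -ge0_integralD//; last 3 first.
  - exact: (mE (fun r => w r ^- m * g r ^+ m.+1)).
  - by move=> r /wD0/ltW wr; rewrite -EFinM lee_fin mulr_ge0// exprn_ge0// ltW.
  - by apply: (mE (fun r => l ^+ m.+1 * w r)); exact: measurable_funM.
  apply: ge0_le_integral_nomeas => r; rewrite /D/= in_itv/= => /andP[r1r _].
    by rewrite lee_fin mulr_ge0// exprn_ge0// ltW.
  rewrite -!EFinM -EFinD lee_fin -/(w r).
  exact: (weighted_young m (g r) l (w r) (g0 r) l0 (w0 _ r1r)).
have E : l ^+ m.+1 * L = l ^+ m / 4.
  by rewrite exprSr -mulrA; congr (_ * _); rewrite /l invfM -mulrA mulVf ?mulr1//; exact: lt0r_neq0.
rewrite -exprVn -/l.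
move: key; rewrite -!EFinM E; case: I => [i| |]; last 2 first.
- by move=> _; exact: leey.
- by rewrite addNye leeNy_eq.
by rewrite -EFinD !lee_fin => key; lra.
Qed.

End one_dimensional.

(** * Lower bound for the integral of Q eta^n over a ring *)

Section ring_lower_bound.
Context {R : realType}.

Lemma EFin_exprn_le_expe (g : R) (x : \bar R) (n : nat) : 0 <= g ->
  (g%:E <= x)%E -> ((g ^+ n)%:E <= x ^+ n)%E.
Proof.
move=> g0 gx; elim: n => [|n IH]; first by rewrite expr0 expe0.
by rewrite exprS expeS EFinM lee_pmul// lee_fin// exprn_ge0.
Qed.

(** Matches the exponent of Q to the Young weight: the slice volume r^m times r^(-am) is the power
    -m of r^(a-1). *)
Lemma powR_weightE (a r : R) (m : nat) (c : R) : 0 < a -> 0 < r ->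
  (r / c) ^+ m * r `^ (- (a * m%:R)) = (a / c) ^+ m * (a * r `^ (a - 1)) ^- m.
Proof.
move=> a0 r0.
rewrite powRN powRrM powR_mulrn ?powR_ge0// -!exprVn -!exprMn; congr (_ ^+ _).
rewrite powRB ?(gt_eqF r0) ?implybT// powRr1 ?(ltW r0)//.
have ra0 : r `^ a != 0 by rewrite gt_eqF// powR_gt0.
rewrite invfM invf_div; move: (c^-1) => d.
by field; rewrite ra0 gt_eqF.
Qed.

(** Every [h] competing in the upper integral lies above a radial Borel function [phi] built from a
    Borel minorant [g] of [eta]; [radial_integral_ge] and [weighted_power_integral_ge] then bound
    the integral of [phi]. *)
Lemma uintegral_ring_ge (k : nat) (a K r1 r2 : R) (eta : R -> \bar R) :
  0 < a -> 0 <= K -> 0 < r1 -> r1 < r2 -> r2 <= 1 ->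
  (forall r, r1 < r < r2 -> (0 <= eta r)%E) ->
  (1 <= \int[ms_mu (clebR R)]_(r in (`]r1, r2[ : set (ms_T (clebR R)))) eta r)%E ->
  ((K * (a / k.+2%:R) ^+ k.+1 * ((4 * (r2 `^ a - r1 `^ a)) ^- k.+1 / 4))%:E <=
   uintegral_Rn (fun x : 'rV[R]_k.+2 =>
     (\1_(annulus0 k.+2 r1 r2 `&` punct_ball k.+2) x)%:E *
     ((K * enorm x `^ (- (a * k.+1%:R)))%:E * eta (enorm x) ^+ k.+2)))%E.
Proof.
move=> a0 K0 r10 r12 r21 eta0 ieta.
have : ((2^-1)%:E < \int[ms_mu (clebR R)]_(r in (`]r1, r2[ : set (ms_T (clebR R)))) eta r)%E.
  by rewrite (lt_le_trans _ ieta)// lte_fin; lra.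
move=> /borel_simple_minorant[|g [mg g0 geta gD ig]].
  by move=> r; rewrite /= in_itv/=; exact: eta0.
pose D : set (measurableTypeR R) := `]r1, r2[%classic.
have mD : measurable D by exact: measurable_itv.
have igD : ((2^-1)%:E <= \int[@lebesgue_measure R]_(r in `]r1, r2[) (g r)%:E)%E.
  rewrite (le_trans ig)// [leRHS]integral_mkcond.
  apply: ge0_le_integral_nomeas => r _; first by rewrite lee_fin.
  by rewrite patchE; case: ifPn => //; rewrite notin_setE => /gD ->.
pose phi r := ((\1_D r)%:E * (K * r `^ (- (a * k.+1%:R)) * g r ^+ k.+2)%:E)%E.
have mphi : measurable_fun [set: R] phi.
  apply: emeasurable_funM; first exact/measurable_EFinP/measurable_indic.
  apply/measurable_EFinP; apply: measurable_funM; last exact: measurable_funX.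
  by apply: measurable_funM => //; exact: measurable_powR.
have phi0 r : (0 <= phi r)%E.
  apply: mule_ge0; rewrite lee_fin//.
  by rewrite mulr_ge0 ?exprn_ge0// mulr_ge0// powR_ge0.
apply: le_ereal_inf_tmp => _ [h [_ hge] <-].
apply: (@le_trans _ _ (\int[ms_mu (lebn R k.+1)]_y phi (enorm (@vec R k.+2 y)))%E); last first.
  apply: ge0_le_integral_nomeas => // y _; apply: le_trans (hge _).
  move: (@vec R k.+2 y) => x; rewrite /phi !indicE.
  case: (boolP (_ \in D)) => [|_]; last first.
    rewrite mul0e; case: (boolP (_ \in _)); rewrite ?mul0e// inE mul1e => -[[x1 x2] _].
    by rewrite mule_ge0 ?lee_fin ?mulr_ge0 ?powR_ge0// expe_ge0// eta0// x1.
  rewrite inE /D/= in_itv/= => xD; have /andP[x1 x2] := xD.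
  (* The bounds [0 < r1] and [r2 <= 1] keep the ring inside the punctured ball, so the indicator is
     1. *)
  rewrite mem_set; last first.
    split; [by split|split; first exact: lt_le_trans r21].
    move=> x0; move: (lt_trans r10 x1).
    by rewrite x0 /enorm big1 ?sqrtr0 ?ltxx// => i _; rewrite mxE expr0n.
  rewrite !mul1e EFinM lee_wpmul2l ?lee_fin ?mulr_ge0 ?powR_ge0//.
  by rewrite EFin_exprn_le_expe// geta//= in_itv/=.
apply: le_trans (radial_integral_ge k phi mphi phi0).
have c0 : 0 <= K * (a / k.+2%:R) ^+ k.+1.
  by rewrite mulr_ge0// exprn_ge0// divr_ge0// ltW.
have wge := weighted_power_integral_ge k.+1 a r1 r2 g a0 r10 r12 mg g0 igD.
rewrite EFinM; apply: le_trans (lee_wpmul2l _ wge) _; first by rewrite lee_fin.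
rewrite -ge0_integralZl//; last 2 first.
- have := measurable_powR_weight k.+1 a g a0 mg.
  by move=> mw; apply/measurable_EFinP; exact: measurable_funTS.
- move=> r _; rewrite lee_fin mulr_ge0// ?exprn_ge0// invr_ge0 exprn_ge0// mulr_ge0 ?powR_ge0//; exact: ltW.
rewrite integral_mkcond [leRHS]integral_mkcond.
apply: ge0_le_integral_nomeas => r _; rewrite !patchE.
  case: ifPn => // _; rewrite -EFinM lee_fin mulr_ge0// mulr_ge0 ?exprn_ge0// invr_ge0 exprn_ge0// mulr_ge0 ?powR_ge0//; exact: ltW.
case: ifPn => [|_]; last first.
  case: ifPn => //; rewrite inE/= in_itv/= andbT => rp.
  by rewrite mule_ge0// lee_fin exprn_ge0// divr_ge0// ltW.
rewrite inE/= in_itv/= => rD; have /andP[r1r rr2] := rD.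
have rp : 0 < r by exact: lt_trans r1r.
rewrite mem_set/= ?in_itv/= ?andbT//.
rewrite /phi indicE mem_set/= ?in_itv// mul1e -!EFinM lee_fin.
rewrite -mulrA [X in _ <= X](_ : _ =
  K * ((r / k.+2%:R) ^+ k.+1 * r `^ (- (a * k.+1%:R)) * g r ^+ k.+2)); last by ring.
by rewrite powR_weightE// !mulrA.
Qed.

End ring_lower_bound.

(** * Modulus of curves crossing a cubic shell *)

Section modulus_upper_bound.
Context {R : realType}.

(** Open rays generate the Borel sets of R, and their preimages under [N] are open. It makes
    functions of a norm, such as the densities and Q, Borel. *)
Lemma borel_set_preimage_continuous (n : nat) (N : 'rV[R]_n -> R) (B : set R) :
  continuous N -> measurable B -> borel_set (N @^-1` B).
Proof.
move=> cN mB.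
pose T := g_sigma_algebraType (@open_sets R n).
suff : measurable_fun (setT : set T) (N : T -> R).
  by move=> /(_ measurableT _ mB); rewrite setTI.
apply: (measurability (@RGenOInfty.G R)); first exact: RGenOInfty.measurableE.
move=> _ [_ [x ->] <-]; rewrite setTI; apply: sub_sigma_algebra.
by move/continuousP: cN; apply; exact: interval_open.
Qed.

Lemma norm_le_enorm (n : nat) (x : 'rV[R]_n) : `|x| <= enorm x.
Proof.
rewrite -[`|_|]/(mx_norm _) mx_normrE; apply/bigmax_leP; split => [|[i j] _ /=].
  exact: sqrtr_ge0.
rewrite (ord1 i) -sqrtr_sqr ler_wsqrtr// (bigD1 j)//= lerDl.
by apply: sumr_ge0 => l _; exact: sqr_ge0.
Qed.

Lemma chord_le_curve_length (n : nat) (g : curve R n) :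
  ((enorm (g 1 - g 0))%:E <= curve_length g 0 1)%E.
Proof.
apply: ereal_sup_ubound; exists 1%N, (fun i => i%:R); split => //; split => //.
by split => [[]//|]; rewrite big_ord1.
Qed.

Lemma arc_param_itv (n : nat) (g : curve R n) (s : R) :
  (s%:E <= curve_length g 0 1)%E -> 0 <= arc_param g s <= 1.
Proof.
move=> sg; rewrite /arc_param; set E := [set t | _].
have E1 : E 1 by split => //; rewrite ler01 lexx.
apply/andP; split; first by apply: lb_le_inf; [exists 1|move=> t [/andP[]]].
by apply: ge_inf => //; exists 0 => t [/andP[]].
Qed.

(** [arc_param] takes values in [0,1], so the integrand is [c] on the whole interval of integration;
    rectifiability makes its length finite, so [fine] loses nothing. *)
Lemma line_integral_cst (n : nat) (g : curve R n) (rho : 'rV[R]_n -> \bar R) (c : R) :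
  loc_rectifiable g -> (forall t, 0 <= t <= 1 -> rho (g t) = c%:E) ->
  line_integral g rho = (c%:E * curve_length g 0 1)%E.
Proof.
move=> /(_ 0 1 (lexx _) ler01 (lexx _)) gfin rhoc.
have g0 : (0 <= curve_length g 0 1)%E.
  by rewrite (le_trans _ (chord_le_curve_length _ g))// lee_fin sqrtr_ge0.
have gE : ((fine (curve_length g 0 1))%:E = curve_length g 0 1)%E.
  by rewrite fineK// ge0_fin_numE.
rewrite /line_integral (_ : [set s : R | _] =
  `[0%R, fine (curve_length g 0 1)]%classic); last first.
  by apply/seteqP; split => s /=; rewrite in_itv.
rewrite (eq_integral (cst c%:E)); last first.
  move=> s; rewrite inE/= in_itv/= => /andP[s0 s1]; apply: rhoc.
  by apply: arc_param_itv; rewrite -gE lee_fin.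
rewrite integral_cst; last exact: measurable_itv.
rewrite [X in (_ * X)%E]lebesgue_measure_itv/= lte_fin; case: ifPn.
  by rewrite sube0 gE.
rewrite -leNgt => le0; rewrite -gE; congr (_ * _)%E; congr EFin.
by apply/eqP; rewrite eq_le le0 fine_ge0.
Qed.

(** The density 1 / (R2 - R1) on the shell is admissible: the length is at least the Euclidean
    chord, hence at least the sup-norm chord, hence at least R2 - R1. The shell is a closed cube
    minus an open one. *)
Lemma modulus_le_shell (k : nat) (Gm : set (curve R k.+1)) (R1 R2 : R) :
  0 < R1 -> R1 < R2 ->
  (forall g, Gm g -> [/\ `|g 0| = R1, `|g 1| = R2 &
     forall t, 0 <= t <= 1 -> R1 <= `|g t| <= R2]) ->
  (modulus Gm <= ((R2 - R1) ^- k.+1 *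
     ((2 * R2) ^+ k.+1 - (2 * R1) ^+ k.+1))%:E)%E.
Proof.
move=> R10 R12 GmP; pose c := (R2 - R1)^-1.
have c0 : 0 < c by rewrite invr_gt0 subr_gt0.
pose F (r : R) := (c * \1_(`[R1, R2]%classic : set R) r)%:E.
have F0 r : (0 <= F r)%E by rewrite lee_fin mulr_ge0// ltW.
apply: ge_ereal_inf; exists (integral_Rn (fun x : 'rV[R]_k.+1 => (F `|x|%R ^+ k.+1)%E)).
  exists (fun x => F `|x|) => //; split.
    move=> B mB; apply: (@borel_set_preimage_continuous _ (@Num.norm _ _) (F @^-1` B)).
      exact: norm_continuous.
    rewrite -[X in measurable X]setTI.
    suff : measurable_fun [set: R] F by exact.
    by apply/measurable_EFinP; apply: measurable_funM => //; exact: measurable_indic.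
  split => // g /GmP[g0 g1 gt] rg.
  rewrite (@line_integral_cst _ _ _ c)//; last first.
    move=> t t01; rewrite /F indicE mem_set ?mulr1//= in_itv/=; exact: gt.
  have : (1 <= c%:E * (enorm (g 1 - g 0))%:E)%E.
    rewrite -EFinM lee_fin /c mulrC ler_pdivlMr ?subr_gt0// mul1r.
    by rewrite -g0 -g1 (le_trans (lerB_dist _ _))// norm_le_enorm.
  move=> /le_trans; apply; rewrite lee_wpmul2l ?lee_fin ?(ltW c0)//.
  exact: chord_le_curve_length.
have R20 : 0 < R2 by exact: lt_trans R12.
pose S := cube k `[- R2, R2]%classic `\` cube k (`]- R1, R1[%classic : set R).
have mS : measurable S by apply: measurableD; exact: measurable_cube.
rewrite /integral_Rn (eq_integral (fun y => (c ^+ k.+1)%:E * (\1_S y)%:E))%E; last first.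
  move=> y _; rewrite -EFin_expe exprMn EFinM; congr (_ * _)%E.
  rewrite !indicE (_ : _ \in `[R1, R2]%classic = (y \in S)).
    by case: (y \in S); rewrite ?expr1n ?expr0n.
  rewrite /S in_setD -le_norm_vec ?(ltW R20)// -lt_norm_vec// -leNgt.
  apply/idP/andP; rewrite inE/= in_itv/=; first by move=> /andP[].
  by move=> [-> ->].
rewrite ge0_integralZl//; last 2 first.
- exact/measurable_EFinP/measurable_indic.
- by rewrite lee_fin exprn_ge0// ltW.
rewrite integral_indic// setIT measureD//; last 3 first.
- exact: measurable_cube.
- exact: measurable_cube.
- by rewrite [X in (X < _)%E](lebn_sym_cube k _ R20).1 ltry.
rewrite setIidr; last first.
  move=> y yR i /yR /=; rewrite !in_itv/= => /andP[y1 y2]; lra.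
rewrite [X in (_ * (X - _))%E](lebn_sym_cube k _ R20).1.
by rewrite [X in (_ * (_ - X))%E](lebn_sym_cube k _ R10).2 -EFinB -EFinM exprVn.
Qed.

(** Each of the n+1 terms in the factorization of y^(n+1) - x^(n+1) is at most y^n. It extracts one
    factor R2 - R1 from the volume of a shell. *)
Lemma subrXX_le (n : nat) (x y : R) : 0 <= x -> x <= y ->
  y ^+ n.+1 - x ^+ n.+1 <= n.+1%:R * y ^+ n * (y - x).
Proof.
move=> x0 xy; have y0 := le_trans x0 xy; rewrite subrXX mulrC ler_wpM2r ?subr_ge0//.
apply: (@le_trans _ _ (\sum_(i < n.+1) y ^+ n)).
  apply: ler_sum => i _ /=.
  rewrite -[in leRHS](@subnK i n) ?exprD; last by rewrite -ltnS.
  by rewrite ler_wpM2l ?exprn_ge0// lerXn2r.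
by rewrite sumr_const card_ord mulr_natl.
Qed.

End modulus_upper_bound.

(** * The map f: homeomorphism, boundedness, essential singularity *)

Section stretch_map.
Context {R : realType}.

(* Sends the Euclidean sphere of radius [r] onto the cube boundary of radius [1 + r^a]. *)
Definition stretch (a : R) (n : nat) (x : 'rV[R]_n) : 'rV[R]_n :=
  ((1 + enorm x `^ a) / `|x|) *: x.

Lemma enorm_ge0 n (x : 'rV[R]_n) : 0 <= enorm x.
Proof. exact: sqrtr_ge0. Qed.

Lemma enorm_gt0 n (x : 'rV[R]_n) : x != 0 -> 0 < enorm x.
Proof. by rewrite -normr_gt0 => /lt_le_trans; apply; exact: norm_le_enorm. Qed.

Lemma enorm0 n : enorm (0 : 'rV[R]_n) = 0.
Proof. by rewrite /enorm big1 ?sqrtr0// => i _; rewrite mxE expr0n. Qed.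

Lemma enormZ n (c : R) (x : 'rV[R]_n) : 0 <= c -> enorm (c *: x) = c * enorm x.
Proof.
move=> c0; rewrite -{2}(ger0_norm c0) -sqrtr_sqr -sqrtrM ?sqr_ge0//.
by rewrite mulr_sumr /enorm; congr Num.sqrt; apply: eq_bigr => i _; rewrite mxE exprMn.
Qed.

Lemma enormN n (x : 'rV[R]_n) : enorm (- x) = enorm x.
Proof. by congr Num.sqrt; apply: eq_bigr => i _; rewrite mxE sqrrN. Qed.

Lemma enorm_le_norm n (x : 'rV[R]_n) : enorm x <= Num.sqrt n%:R * `|x|.
Proof.
rewrite -[X in _ <= _ * X]ger0_norm// -sqrtr_sqr -sqrtrM// ler_wsqrtr//.
apply: (@le_trans _ _ (\sum_(i < n) `|x| ^+ 2)).
  apply: ler_sum => i _; rewrite -real_normK ?num_real// lerXn2r ?nnegrE//.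
  rewrite -[`|x|]/(mx_norm _) mx_normrE.
  exact: (le_bigmax _ (fun ij => `|x ij.1 ij.2|) (ord0, i)).
by rewrite sumr_const card_ord mulr_natl.
Qed.

Lemma continuous_enorm n : continuous (@enorm R n).
Proof.
have cS : continuous (fun x : 'rV[R]_n => \sum_(i < n) x ord0 i ^+ 2).
  apply: continuous_big => [|i _ x]; first exact: add_continuous.
  apply: (@continuous_comp _ _ _ (fun x : 'rV[R]_n => x ord0 i) (fun t => t ^+ 2)).
    exact: coord_continuous.
  exact: exprn_continuous.
move=> x; apply: (@continuous_comp _ _ _ _ (@Num.sqrt R)); first exact: cS.
exact: sqrt_continuous.
Qed.

Lemma stretchN a n (x : 'rV[R]_n) : stretch a n (- x) = - stretch a n x.
Proof. by rewrite /stretch enormN normrN scalerN. Qed.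

Lemma norm_stretch a n (x : 'rV[R]_n) : x != 0 ->
  `|stretch a n x| = 1 + enorm x `^ a.
Proof.
move=> x0; rewrite /stretch normrZ ger0_norm.
  by rewrite divfK// normr_eq0.
by rewrite divr_ge0// addr_ge0// powR_ge0.
Qed.

Lemma continuous_stretch a n (x : 'rV[R]_n) : x != 0 ->
  {for x, continuous (stretch a n)}.
Proof.
move=> x0; apply: (@continuousZ _ _ _ (fun x => (1 + enorm x `^ a) / `|x|) id); last exact: cvg_id.
apply: continuousM.
  have c1 : {for x, continuous (fun x : 'rV[R]_n => enorm x `^ a)}.
    apply: (@continuous_comp _ _ _ (@enorm R n) (@powR R ^~ a)); first exact: continuous_enorm.
    by apply: continuous_powR_gt0; exact: enorm_gt0.
  exact: (cvgD (cvg_cst (1 : R)) c1).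
apply: continuousV; first by rewrite normr_eq0.
exact: norm_continuous.
Qed.

Lemma homeomorphism_stretch a n : 0 < a -> homeomorphism_on (punct_ball n) (stretch a n).
Proof.
move=> a0; split.
  apply: continuous_in_subspaceT => x; rewrite inE => -[_ /eqP x0].
  exact: continuous_stretch.
(* The direction is preserved, and the sup norm 1 + |x|^a of the image determines |x|. *)
exists (fun y => ((`|y| - 1) `^ a^-1 / enorm y) *: y); split.
  move=> x [_ /eqP x0]; rewrite norm_stretch// addrAC subrr add0r -powRrM.
  rewrite mulfV ?gt_eqF// powRr1 ?enorm_ge0//.
  rewrite /stretch; set s := (_ / `|x|).
  have s0 : 0 < s by rewrite divr_gt0 ?normr_gt0// ltr_wpDr ?powR_ge0.
  have xn : enorm x != 0 by rewrite gt_eqF ?enorm_gt0.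
  rewrite enormZ ?(ltW s0)// scalerA.
  have -> : enorm x / (s * enorm x) * s = 1 by field; rewrite xn gt_eqF.
  by rewrite scale1r.
apply: continuous_in_subspaceT => y; rewrite inE => -[x [_ /eqP x0] <-{y}].
set y := stretch a n x.
have y1 : 0 < `|y| - 1.
  by rewrite norm_stretch// addrAC subrr add0r powR_gt0// enorm_gt0.
have y0 : y != 0 by rewrite -normr_gt0; lra.
apply: (@continuousZ _ _ _ (fun y => (`|y| - 1) `^ a^-1 / enorm y) id); last exact: cvg_id.
apply: continuousM.
  apply: (@continuous_comp _ _ _ (fun y : 'rV[R]_n => `|y| - 1) (@powR R ^~ a^-1)).
    exact: (cvgB (@norm_continuous _ _ y) (cvg_cst (1 : R))).
  exact: continuous_powR_gt0.
apply: continuousV; first by rewrite gt_eqF// enorm_gt0.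
exact: continuous_enorm.
Qed.

Lemma enorm_stretch_le a n (x : 'rV[R]_n) : 0 < a -> punct_ball n x ->
  enorm (stretch a n x) <= Num.sqrt n%:R * 2.
Proof.
move=> a0 [x1 /eqP x0]; apply: le_trans (enorm_le_norm _ _) _.
rewrite ler_wpM2l ?sqrtr_ge0// norm_stretch//.
have : enorm x `^ a <= 1 `^ a.
  by apply: ge0_ler_powR; rewrite ?nnegrE ?enorm_ge0 ?(ltW a0) ?(ltW x1).
by rewrite powR1; lra.
Qed.

(** The map is odd with sup norm at least 1, so the values at x and -x are at sup distance at least
    2 and cannot both be within 1 of a limit. Boundedness excludes an infinite limit. *)
Lemma essential_singularity_stretch a n : (0 < n)%N -> 0 < a ->
  essential_singularity_at0 (stretch a n).
Proof.
case: n => // n _ a0.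
pose e : 'rV[R]_n.+1 := delta_mx ord0 ord0.
have ene : enorm e = 1.
  rewrite /enorm (bigD1 ord0)//= big1 => [|i i0]; rewrite mxE eqxx/=.
    by rewrite expr1n addr0 sqrtr1.
  by rewrite (negPf i0) expr0n.
have e0 : e != 0.
  by apply/eqP => e0; move: ene; rewrite e0 enorm0 => /esym/eqP; rewrite oner_eq0.
have small (d : R) : 0 < d -> exists x : 'rV[R]_n.+1,
    [/\ punct_ball n.+1 x, x != 0 & enorm x < d].
  move=> d0; pose t := Num.min d 1 / 2.
  have [td t1 t0] : [/\ t < d, t < 1 & 0 < t].
    by rewrite /t; case: (lerP d 1) => ?; split; lra.
  have te0 : t *: e != 0 by rewrite scaler_eq0 negb_or e0 gt_eqF.
  exists (t *: e); rewrite enormZ ?(ltW t0)// ene mulr1; split => //; split.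
    by rewrite enormZ ?(ltW t0)// ene mulr1.
  exact/eqP.
split.
  move=> [L /(_ 1 ltr01)[d [/small[x [xb x0 xd]] fL]]].
  have := fL _ xb xd; have := fL (- x).
  rewrite enormN stretchN => /(_ _ xd) f1 f2.
  have {}f1 : enorm (- stretch a n.+1 x - L) < 1.
    by apply: f1; split; [rewrite enormN; exact: xb.1|apply/eqP; rewrite oppr_eq0].
  have := le_lt_trans (norm_le_enorm _ _) f1; have := le_lt_trans (norm_le_enorm _ _) f2.
  move=> g2 g1.
  have : `|stretch a n.+1 x *+ 2| < 2.
    rewrite (_ : _ *+ 2 = (stretch a n.+1 x - L) - (- stretch a n.+1 x - L)).
      by rewrite (le_lt_trans (ler_normB _ _))//; lra.
    by rewrite opprD !opprK addrACA addNr addr0.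
  rewrite normrMn norm_stretch// -mulr_natl.
  by have := powR_ge0 (enorm x) a; lra.
move=> /(_ (Num.sqrt n.+1%:R * 2))[d [/small[x [xb _ xd]] fM]].
by have := fM x xb xd; rewrite ltNge enorm_stretch_le.
Qed.

End stretch_map.

(** * Integrability of Q and the modulus of the image family *)

Section ring_Q_stretch.
Context {R : realType}.

Lemma dyadic_scale (s : R) : 0 < s -> s <= 1 ->
  exists j : nat, 4^-1 ^+ j.+1 < s <= 4^-1 ^+ j.
Proof.
move=> s0 s1.
have ex : exists j : nat, 4^-1 ^+ j.+1 < s.
  have : (4^-1 : R) ^+ n @[n --> \oo] --> 0 by apply: cvg_expr; rewrite ger0_norm; lra.
  move=> /cvgr0Pnorm_lt/(_ _ s0)[N _ /(_ N.+1 (leqnSn N)) h].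
  by exists N; move: h; rewrite ger0_norm// exprn_ge0//; lra.
(* The least such [j] works: minimality gives the upper bound, except for [j = 0], where it is
   [s <= 1]. *)
have [j js jmin] := ex_minnP ex; exists j; rewrite js/=.
case: j js jmin => [//|j js jmin]; rewrite leNgt; apply/negP => /jmin.
by rewrite ltnn.
Qed.

(** Scales are powers of 4 so that their square roots are powers of 2. Here [s] stands for the sup
    norm and [t] for the Euclidean norm of a point. *)
Lemma powR_half_le_dyadic (s t : R) (j : nat) : 4^-1 ^+ j.+1 < s -> s <= t ->
  t `^ (- 2^-1) <= 2 ^+ j.+1.
Proof.
move=> js st; have j0 : 0 < (4^-1 : R) ^+ j.+1 by rewrite exprn_gt0//; lra.
have t0 : 0 < t by rewrite (lt_trans j0)// (lt_le_trans js).
rewrite powRN powR12_sqrt ?(ltW t0)// -[leRHS]invrK lef_pV2 ?posrE ?sqrtr_gt0 ?invr_gt0 ?exprn_gt0//.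
rewrite -[leLHS]ger0_norm ?invr_ge0 ?exprn_ge0// -sqrtr_sqr ler_wsqrtr//.
rewrite (le_trans _ (le_trans (ltW js) st))// -exprVn exprAC.
by rewrite (_ : 2^-1 ^+ 2 = 4^-1)//; lra.
Qed.

Lemma sum_half_le (N : nat) : \sum_(0 <= j < N) (2^-1 : R) ^+ j <= 2.
Proof.
suff -> : \sum_(0 <= j < N) (2^-1 : R) ^+ j = 2 - 2 * 2^-1 ^+ N.
  have : 0 <= (2^-1 : R) ^+ N by rewrite exprn_ge0.
  lra.
elim: N => [|N IH]; first by rewrite big_geq// expr0; lra.
by rewrite big_nat_recr//= IH exprS; lra.
Qed.

(* The ball is covered by the dyadic shells between the cubes of radii [4^-(j+1)] and [4^-j]. *)
Lemma in_Lp_ball_powR (k : nat) (K b p : R) : 0 <= K -> 0 < p -> b * p = 2^-1 ->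
  in_Lp_ball p (fun x : 'rV[R]_k.+1 => K * enorm x `^ (- b)).
Proof.
move=> K0 p0 bp; rewrite /in_Lp_ball /integral_Rn /=.
pose C j := cube k (`[- (4^-1 ^+ j), 4^-1 ^+ j]%classic : set R).
have mC j : measurable (C j) by exact: measurable_cube.
have r0 j : 0 < (4^-1 : R) ^+ j by rewrite exprn_gt0//; lra.
(* The constant bounds |Q|^p on the shell of index [j]; placing it on the whole cube only enlarges
   the sum. *)
pose u j y := ((K `^ p * 2 ^+ j.+1)%:E * (\1_(C j) y)%:E)%E.
have c0 j : 0 <= K `^ p * 2 ^+ j.+1 by rewrite mulr_ge0 ?powR_ge0 ?exprn_ge0.
have u0 j y : (0 <= u j y)%E by rewrite mule_ge0// lee_fin.
have mu j : measurable_fun setT (u j).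
  by apply: emeasurable_funM => //; exact/measurable_EFinP/measurable_indic.
apply: (@le_lt_trans _ _ (\int[ms_mu (lebn R k)]_y \sum_(0 <= j <oo) u j y)%E).
  apply: ge0_le_integral_nomeas => y _; first by rewrite mule_ge0// lee_fin powR_ge0.
  rewrite indicE; case: (boolP (_ \in _)); last first.
    by rewrite mul0e nneseries_ge0.
  rewrite inE /unit_ball/= => y1; rewrite mul1e.
  rewrite ger0_norm ?mulr_ge0 ?powR_ge0// powRM ?powR_ge0// -powRrM mulNr bp.
  (* The origin lies in no shell, but there [powR] of 0 to a nonzero exponent is 0. *)
  have [y0|y0] := eqVneq (@vec R k.+1 y) 0.
    have h2 : - 2^-1 != 0 :> R by rewrite oppr_eq0 invr_eq0 pnatr_eq0.
    by rewrite y0 enorm0 powR0// mulr0; exact: nneseries_ge0.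
  have := norm_le_enorm _ (@vec R k.+1 y) => nen.
  have [j /andP[js sj]] : exists j : nat, 4^-1 ^+ j.+1 < `|@vec R k.+1 y| <= 4^-1 ^+ j.
    by apply: dyadic_scale; rewrite ?normr_gt0// (le_trans nen)// ltW.
  apply: (@le_trans _ _ (u j y)).
    rewrite /u indicE -le_norm_vec ?(ltW (r0 j))// sj mule1 lee_fin.
    by rewrite ler_wpM2l ?powR_ge0// (powR_half_le_dyadic _ _ _ js).
  apply: le_trans (nneseries_lim_ge j.+1 _) => //.
  by rewrite big_nat_recr//= leeDr// sume_ge0.
rewrite integral_nneseries//.
pose M := K `^ p * 2 ^+ k.+2.
apply: (@le_lt_trans _ _ (M * 2)%:E); last by rewrite ltry.
have M0 : 0 <= M by rewrite mulr_ge0 ?powR_ge0 ?exprn_ge0.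
apply: lime_le; first by apply: is_cvg_nneseries => j _ _; exact: integral_ge0.
apply: nearW => N.
apply: (@le_trans _ _ (\sum_(0 <= j < N) (M * 2^-1 ^+ j)%:E)%E); last first.
  by rewrite sumEFin lee_fin -mulr_sumr ler_wpM2l// sum_half_le.
apply: lee_sum => j _; rewrite ge0_integralZl//; last 2 first.
- exact/measurable_EFinP/measurable_indic.
- by rewrite lee_fin.
rewrite integral_indic// setIT (lebn_sym_cube k _ (r0 j)).1 -EFinM lee_fin.
have -> : K `^ p * 2 ^+ j.+1 * (2 * 4^-1 ^+ j) ^+ k.+1 =
    M * (2 ^+ j * (4^-1 ^+ j) ^+ k.+1).
  by rewrite /M exprMn (exprS _ j) (exprS _ k.+1); ring.
rewrite ler_wpM2l//.
(* One factor 4^-j of the volume already outweighs 2^j and leaves a geometric series of ratio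
   1/2. *)
apply: (@le_trans _ _ (2 ^+ j * 4^-1 ^+ j)).
  rewrite ler_wpM2l ?exprn_ge0// exprS ler_piMr ?(ltW (r0 j))//.
  by rewrite !exprn_ile1 ?(ltW (r0 j))//; lra.
by rewrite -exprMn (_ : 2 * 4^-1 = 2^-1)//; lra.
Qed.

(** The shell bound carries D^-(k+2), and [subrXX_le] takes a factor 2 D out of the difference of
    volumes, leaving D^-(k+1). The power of 4 comes from 2 (1 + r2^a) <= 4. *)
Lemma modulus_stretch_le (k : nat) (a r1 r2 : R) :
  0 < a -> 0 < r1 -> r1 < r2 -> r2 <= 1 ->
  (modulus (image_family (stretch a k.+2)
     (Gamma (sphere0 k.+2 r1) (sphere0 k.+2 r2) (annulus0 k.+2 r1 r2))) <=
   (k.+2%:R * 4 ^+ k.+1 * 2 * (r2 `^ a - r1 `^ a) ^- k.+1)%:E)%E.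
Proof.
move=> a0 r10 r12 r21; set D := r2 `^ a - r1 `^ a.
have pow_le (x y : R) : 0 <= x -> x <= y -> x `^ a <= y `^ a.
  by move=> x0 xy; apply: ge0_ler_powR; rewrite ?nnegrE ?(ltW a0)// (le_trans x0).
have D0 : 0 < D.
  by rewrite subr_gt0 gt0_ltr_powR// ?nnegrE ?(ltW r10)// (le_trans (ltW r10))// ltW.
have r2a : r2 `^ a <= 1.
  by rewrite -[leRHS](congr1 (@^~ a) (@powR1 R)) pow_le// ltW// (lt_trans r10).
apply: le_trans (modulus_le_shell k.+1 _ (1 + r1 `^ a) (1 + r2 `^ a) _ _ _) _.
- by rewrite ltr_wpDr ?powR_ge0.
- by rewrite ltrD2l -subr_gt0.
- move=> _ [g [[_ [g0 [g1 gt]]] gb] <-] /=.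
  have nz t : 0 <= t <= 1 -> g t != 0 by move=> /gb[_ /eqP].
  rewrite !norm_stretch ?nz ?lexx ?ler01//.
  rewrite g0 g1; split => // t t01; rewrite norm_stretch ?nz//.
  (* [Gamma] confines the curve to the open ring for 0 < t < 1 only; the endpoints lie on the
     spheres. *)
  suff /andP[h1 h2] : r1 <= enorm (g t) <= r2.
    by rewrite !lerD2l !pow_le ?enorm_ge0// ltW.
  have /andP[t0 t1] := t01.
  have [->|tn0] := eqVneq t 0; first by rewrite g0 lexx ltW.
  have [->|tn1] := eqVneq t 1; first by rewrite g1 lexx ltW.
  have [] := gt t; first by rewrite !lt_neqAle eq_sym tn0 tn1 t0.
  by move=> /ltW-> /ltW->.
rewrite lee_fin opprD addrACA subrr add0r -/D.
have sub := subrXX_le k.+1 (2 * (1 + r1 `^ a)) (2 * (1 + r2 `^ a)).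
apply: (@le_trans _ _ (D ^- k.+2 * (k.+2%:R * 4 ^+ k.+1 * (2 * D)))); last first.
  rewrite [D ^+ k.+2]exprS invfM.
  have Dk : D ^+ k.+1 != 0 by rewrite gt_eqF// exprn_gt0.
  by rewrite le_eqVlt; apply/orP; left; apply/eqP; field; rewrite Dk gt_eqF.
rewrite ler_wpM2l ?invr_ge0 ?exprn_ge0 ?(ltW D0)//.
have p1 := powR_ge0 r1 a; have p2 := powR_ge0 r2 a.
apply: le_trans (sub _ _) _; [lra|by move: D0; rewrite /D; lra|].
rewrite [X in _ * X](_ : _ = 2 * D); last by rewrite /D; ring.
rewrite ler_wpM2r ?mulr_ge0 ?(ltW D0)// ler_wpM2l// lerXn2r ?nnegrE//; lra.
Qed.

(** The zero density is vacuously admissible. *)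
Lemma modulus_set0 (k : nat) : (modulus (@set0 (curve R k.+1)) <= 0)%E.
Proof.
apply: ge_ereal_inf; exists (integral_Rn (fun x : 'rV[R]_k.+1 => (0 ^+ k.+1)%E)).
  exists (fun=> 0%E) => //; split => //.
  move=> B mB; apply: (@borel_set_preimage_continuous _ _ (@Num.norm _ _) ((fun=> 0%E) @^-1` B)).
    exact: norm_continuous.
  by rewrite -[X in measurable X]setTI; exact: measurable_cst.
by rewrite /integral_Rn integral0_eq// => y _; rewrite expeS mul0e.
Qed.

End ring_Q_stretch.

(** * Choice of the constants, and rings that leave the ball *)

Theorem theorem7 (R : realType) (n : nat) (p : R) :
  (2 <= n)%N -> 1 < p ->
  exists (Q : 'rV[R]_n -> R) (f : 'rV[R]_n -> 'rV[R]_n),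
    (forall x, 0 <= Q x) /\ borel_rfun Q /\ in_Lp_ball p Q /\
    homeomorphism_on (punct_ball n) f /\ bounded_on (punct_ball n) f /\
    ring_Q_mapping_at0 f Q /\ essential_singularity_at0 f.
Proof.
case: n => [|[|k]]// _ p1; have p0 : 0 < p by lra.
(* With m = k+1 this gives a m p = 1/2, the exponent required by [in_Lp_ball_powR]. *)
pose a : R := (2 * (k.+1%:R * p))^-1.
have kp0 : 0 < k.+1%:R * p by rewrite mulr_gt0.
have a0 : 0 < a by rewrite invr_gt0 mulr_gt0.
(* The constant of [modulus_stretch_le] divided by those of [uintegral_ring_ge]: the two bounds then
   coincide. *)
pose K : R := k.+2%:R * 4 ^+ k.+1 * 2 * (a / k.+2%:R) ^- k.+1 * 4 ^+ k.+1 * 4.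
have ak0 : 0 < (a / k.+2%:R) ^+ k.+1 by rewrite exprn_gt0// divr_gt0.
have K0 : 0 <= K by rewrite !mulr_ge0// ?exprn_ge0// invr_ge0 ltW.
exists (fun x => K * enorm x `^ (- (a * k.+1%:R))), (stretch a k.+2).
split; first by move=> x; rewrite mulr_ge0 ?powR_ge0.
split.
  move=> B mB.
  apply: (@borel_set_preimage_continuous _ _ (@enorm R k.+2)
    ((fun r : R => K * r `^ (- (a * k.+1%:R))) @^-1` B)).
    exact: continuous_enorm.
  rewrite -[X in measurable X]setTI.
  suff : measurable_fun [set: R] (fun r : R => K * r `^ (- (a * k.+1%:R))) by exact.
  by apply: measurable_funM => //; exact: measurable_powR.
split.
  apply: in_Lp_ball_powR => //; rewrite -mulrA /a invfM -mulrA mulVf ?mulr1//.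
  by rewrite gt_eqF.
split; first exact: homeomorphism_stretch.
split; first by exists (Num.sqrt k.+2%:R * 2) => x; exact: enorm_stretch_le.
split; last exact: essential_singularity_stretch.
move=> r1 r2 r10 r12 eta _ eta0 ieta.
have [r21|r21] := ltP r2 1.
  apply: le_trans (modulus_stretch_le k a r1 r2 a0 r10 r12 (ltW r21)) _.
  apply: le_trans (uintegral_ring_ge k a K r1 r2 eta a0 K0 r10 r12 (ltW r21) eta0 ieta).
  rewrite lee_fin (exprMn _ 4) invfM /K.
  move: ak0; set A := (a / _) ^+ _ => A0; set X := (_ - _) ^- _.
  have : (4 : R) ^+ k.+1 != 0 by rewrite gt_eqF// exprn_gt0.
  set B := 4 ^+ _ => B0.
  by rewrite le_eqVlt; apply/orP; left; apply/eqP; field; rewrite B0 gt_eqF.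
(* For [r2 >= 1] a curve would have its endpoint [g 1] outside the ball, so no curve is mapped, and
   it remains to see that the right side is nonnegative. *)
rewrite (_ : image_family _ _ = set0); last first.
  rewrite -subset0 => c [g [[_ [_ [g1 _]]] gb] _].
  have [] := gb 1; first by rewrite ler01 lexx.
  by rewrite g1 ltNge r21.
apply: le_trans (modulus_set0 _) _.
apply: le_ereal_inf_tmp => _ [h [_ hge] <-]; apply: integral_ge0 => y _.
apply: le_trans (hge _); rewrite indicE; case: (boolP (_ \in _)); rewrite ?mul0e//.
rewrite inE mul1e => -[[x1 x2] _].
apply: mule_ge0; first by rewrite lee_fin mulr_ge0 ?powR_ge0.
by apply: expe_ge0; apply: eta0; rewrite x1.
Qed.
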